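(* Let $(A,\nwarrow,\nearrow,\swarrow,\searrow)$ be a quadri-algebra and let $r\in A\otimes A$ be skew-symmetric. Define, for $x\in A$, $$\alpha(x)=(-1\otimes L_\searrow(x)+R_\star(x)\otimes1)r,\quad \beta(x)=(1\otimes L_\vee(x)-R_\prec(x)\otimes1)r,$$ $$\tilde\alpha(x)=(1\otimes L_\succ(x)-R_\wedge(x)\otimes1)r,\quad \tilde\beta(x)=(-1\otimes L_\star(x)+R_\nwarrow(x)\otimes1)r.$$ Then $(A,\nwarrow,\nearrow,\swarrow,\searrow,\alpha,\beta,\tilde\alpha,\tilde\beta)$ is a quadri-bialgebra if and only if the following nine equations hold for all $x\in A$: $$(1\otimes1\otimes L_\searrow(x)-R_\star(x)\otimes1\otimes1)(Q_1^2-Q_3^1)=0,$$ $$(1\otimes1\otimes L_\searrow(x)-R_\prec(x)\otimes1\otimes1)Q_1^2=0,$$ $$(1\otimes1\otimes L_\vee(x)-R_\prec(x)\otimes1\otimes1)Q_3^1=0,$$ $$(1\otimes1\otimes L_\searrow(x)-R_\wedge(x)\otimes1\otimes1)Q_2^1=0,$$ $$(1\otimes1\otimes L_\searrow(x)-R_\nwarrow(x)\otimes1\otimes1)(Q_2^1+Q_3^2)=0,$$ $$(1\otimes1\otimes L_\vee(x)-R_\nwarrow(x)\otimes1\otimes1)Q_3^2=0,$$ $$(1\otimes1\otimes L_\succ(x)-R_\wedge(x)\otimes1\otimes1)Q_2^2=0,$$ $$(1\otimes1\otimes L_\succ(x)-R_\nwarrow(x)\otimes1\otimes1)Q_1^1=0,$$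 $$(1\otimes1\otimes L_\star(x)-R_\nwarrow(x)\otimes1\otimes1)(Q_3^1+Q_3^2)=0,$$ where $$Q_1^1=r_{23}\wedge r_{12}-r_{13}\succ r_{23}+r_{12}\swarrow r_{13},\quad Q_1^2=r_{23}\vee r_{12}-r_{12}\prec r_{13}+r_{13}\nearrow r_{23},$$ $$Q_2^1=r_{12}\wedge r_{13}-r_{23}\succ r_{12}-r_{13}\swarrow r_{23},\quad Q_2^2=r_{12}\vee r_{13}+r_{13}\prec r_{23}+r_{23}\nearrow r_{12},$$ $$Q_3^1=r_{13}\wedge r_{23}+r_{12}\succ r_{13}+r_{23}\swarrow r_{12},\quad Q_3^2=r_{13}\vee r_{23}-r_{23}\prec r_{12}-r_{12}\nearrow r_{13}.$$
   Context: All vector spaces are finite-dimensional over a fixed field $\mathbb F$. A quadri-algebra $(A,\nwarrow,\nearrow,\swarrow,\searrow)$ is a vector space with four bilinear operations; put $x\succ y=x\nearrow y+x\searrow y$, $x\prec y=x\nwarrow y+x\swarrow y$, $x\vee y=x\swarrow y+x\searrow y$, $x\wedge y=x\nwarrow y+x\nearrow y$, $x\star y=x\nwarrow y+x\nearrow y+x\swarrow y+x\searrow y$; the axioms are, for all $x,y,z$: $(x\nwarrow y)\nwarrow z=x\nwarrow(y\star z)$, $(x\nearrow y)\nwarrow z=x\nearrow(y\prec z)$, $(x\wedge y)\nearrow z=x\nearrow(y\succ z)$, $(x\swarrow y)\nwarrow z=x\swarrow(y\wedge z)$, $(x\searrow y)\nwarrow z=x\searrow(y\nwarrow z)$, $(x\vee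 y)\nearrow z=x\searrow(y\nearrow z)$, $(x\prec y)\swarrow z=x\swarrow(y\vee z)$, $(x\succ y)\swarrow z=x\searrow(y\swarrow z)$, $(x\star y)\searrow z=x\searrow(y\searrow z)$. $L_\circ(x)y=x\circ y=R_\circ(y)x$. The element $r$ is skew-symmetric if $\tau(r)=-r$, $\tau$ being the flip. For $r=\sum_ia_i\otimes b_i$ write formally $r_{12}=\sum a_i\otimes b_i\otimes1$, $r_{13}=\sum a_i\otimes1\otimes b_i$, $r_{23}=\sum1\otimes a_i\otimes b_i$; for a bilinear operation $\diamond$, $r_{pq}\diamond r_{st}\in A^{\otimes3}$ is the componentwise product with $1$ acting as a unit, i.e. $r_{12}\diamond r_{13}=\sum_{i,j}a_i\diamond a_j\otimes b_i\otimes b_j$, $r_{13}\diamond r_{23}=\sum_{i,j}a_i\otimes a_j\otimes b_i\diamond b_j$, $r_{23}\diamond r_{12}=\sum_{i,j}a_j\otimes a_i\diamond b_j\otimes b_i$. $(A,\alpha,\beta,\tilde\alpha,\tilde\beta)$ with linear maps $A\to A\otimes A$ is a quadri-coalgebra if $(A^*,\alpha^*,\beta^*,\tilde\alpha^*,\tilde\beta^* )$ is a quadri-algebra (in the order $\nwarrow,\nearrow,\swarrow,\searrow$), where $\langle\alpha^*(a^*\otimes b^* ),x\rangle=\langle a^*\otimes b^*,\alpha(x)\rangle$, etc. A quadri-bialgebra is a quadri-algebra that is also a quadri-coalgebra such that for all $x,y\in A$: $\tilde\alpha(x\star y)=(R_\wedge(y)\otimes1)\tilde\alpha(x)+(1\otimes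 L_\succ(x))\tilde\alpha(y)$; $\beta(x\star y)=(R_\prec(y)\otimes1)\beta(x)+(1\otimes L_\vee(x))\beta(y)$; $(\beta+\tilde\beta)(x\wedge y)=(R_\nwarrow(y)\otimes1)(\beta+\tilde\beta)(x)+(1\otimes L_\wedge(x))\tilde\beta(y)$; $(\alpha+\tilde\alpha)(x\wedge y)=(R_\wedge(y)\otimes1)(\alpha+\tilde\alpha)(x)+(1\otimes L_\nearrow(x))\tilde\alpha(y)$; $(\beta+\tilde\beta)(x\vee y)=(1\otimes L_\vee(x))(\beta+\tilde\beta)(y)+(R_\swarrow(y)\otimes1)\beta(x)$; $(\alpha+\tilde\alpha)(x\vee y)=(1\otimes L_\searrow(x))(\alpha+\tilde\alpha)(y)+(R_\vee(y)\otimes1)\alpha(x)$; $(\alpha+\beta)(x\succ y)=(1\otimes L_\searrow(x))(\alpha+\beta)(y)+(R_\succ(y)\otimes1)\alpha(x)$; $(\tilde\alpha+\tilde\beta)(x\succ y)=(1\otimes L_\succ(x))(\tilde\alpha+\tilde\beta)(y)+(R_\nearrow(y)\otimes1)\tilde\alpha(x)$; $(\alpha+\beta)(x\prec y)=(R_\prec(y)\otimes1)(\alpha+\beta)(x)+(1\otimes L_\swarrow(x))\beta(y)$; $(\tilde\alpha+\tilde\beta)(x\prec y)=(R_\nwarrow(y)\otimes1)(\tilde\alpha+\tilde\beta)(x)+(1\otimes L_\prec(x))\tilde\beta(y)$; $(1\otimes L_\succ(y)-R_\wedge(y)\otimes1)\tau\beta(x)=(1\otimes R_\prec(x)-L_\vee(x)\otimes1)\tilde\alpha(y)$;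 $(1\otimes R_\nwarrow(x)-L_\vee(x)\otimes1)(\alpha+\tilde\alpha)(y)=(1\otimes L_\nearrow(y))\tau\beta(x)-(R_\vee(y)\otimes1)\tau\tilde\beta(x)$; $(R_\wedge(y)\otimes1-1\otimes L_\searrow(y))(\tau\beta+\tau\tilde\beta)(x)=(L_\wedge(x)\otimes1)\alpha(y)-(1\otimes R_\swarrow(x))\tilde\alpha(y)$; $(1\otimes L_\succ(x)-R_\nwarrow(x)\otimes1)(\tau\alpha+\tau\beta)(y)=(1\otimes R_\succ(y))\tilde\beta(x)-(L_\swarrow(y)\otimes1)\tilde\alpha(x)$; $(1\otimes L_\searrow(x)-R_\prec(x)\otimes1)(\tau\tilde\alpha+\tau\tilde\beta)(y)=(1\otimes R_\nearrow(y))\beta(x)-(L_\prec(y)\otimes1)\alpha(x)$; $(\alpha+\tilde\alpha+\beta+\tilde\beta)(x\swarrow y)=(R_\swarrow(y)\otimes1)(\alpha+\beta)(x)+(1\otimes L_\swarrow(x))(\beta+\tilde\beta)(y)$; $(\alpha+\beta+\tilde\alpha+\tilde\beta)(x\nearrow y)=(R_\nearrow(y)\otimes1)(\alpha+\tilde\alpha)(x)+(1\otimes L_\nearrow(x))(\tilde\alpha+\tilde\beta)(y)$; $(L_\swarrow(y)\otimes1)(\alpha+\tilde\alpha)(x)+(1\otimes L_\nearrow(x))(\tau\alpha+\tau\beta)(y)=(R_\swarrow(x)\otimes1)(\tau\tilde\alpha+\tau\tilde\beta)(y)+(1\otimes R_\nearrow(y))(\beta+\tilde\beta)(x)$. *)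

(* Defs.v *)
From HB Require Import structures.
From mathcomp Require Export all_boot all_order all_algebra.

Set Implicit Arguments.
Unset Strict Implicit.
Unset Printing Implicit Defensive.

Import GRing.Theory.
Local Open Scope ring_scope.

(* MathComp has no tensor product of vector spaces.  [tensor U V] is the space
   of coordinate arrays of U (x) V in the basis e_i (x) e'_j, where e and e' are
   the chosen bases [vbasis fullv] of U and V; the lemmas [tens_bilinear],
   [tlift_linear], [tlift_tens] and [tlift_unique] are its universal property. *)
Section Tensor.
Variable F : fieldType.
Implicit Types U V W : vectType F.

Definition bilinear_op U V W (f : U -> V -> W) : Prop :=
  (forall u, linear (f u)) /\ (forall v, linear (f^~ v)).

Definition tensor U V : vectType F := 'M[F]_(\dim {:U}, \dim {:V}).

Definition tens U V (u : U) (v : V) : tensor U V :=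
  \matrix_(i, j) (coord (vbasis {:U}) i u * coord (vbasis {:V}) j v).

(* For bilinear f, the linear map U (x) V -> W sending u (x) v to f u v. *)
Definition tlift U V W (f : U -> V -> W) (t : tensor U V) : W :=
  \sum_i \sum_j (t : 'M[F]__) i j *: f (vbasis {:U})`_i (vbasis {:V})`_j.

Definition tmap U U' V V' (f : U -> U') (g : V -> V') :
    tensor U V -> tensor U' V' :=
  tlift (fun u v => tens (f u) (g v)).

Definition tmapl U U' V (f : U -> U') : tensor U V -> tensor U' V :=
  tmap f id.

Definition tmapr U V V' (g : V -> V') : tensor U V -> tensor U V' :=
  tmap id g.

(* Triple tensors are bracketed as A (x) (A (x) A). *)
Definition tmap3 U U' V V' W W' (f : U -> U') (g : V -> V') (h : W -> W') :
    tensor U (tensor V W) -> tensor U' (tensor V' W') :=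
  tmap f (tmap g h).

Definition flip U V : tensor U V -> tensor V U :=
  tlift (fun u v => tens v u).

Definition skew_symmetric V (r : tensor V V) : Prop := flip r = - r.

Lemma tens_bilinear U V : bilinear_op (@tens U V).
Proof.
split=> [u|v] a x y; apply/matrixP => i j; rewrite !mxE linearP /=.
  by rewrite mulrDr mulrCA.
by rewrite mulrDl mulrA.
Qed.

Lemma tlift_linear U V W (f : U -> V -> W) : linear (tlift f).
Proof.
move=> a s t; rewrite /tlift scaler_sumr -big_split; apply: eq_bigr => i _ /=.
rewrite scaler_sumr -big_split; apply: eq_bigr => j _ /=.
by rewrite !mxE scalerDl scalerA.
Qed.

Lemma tlift_tens U V W (f : U -> V -> W) u v :
  bilinear_op f -> tlift f (tens u v) = f u v.
Proof.
case=> fr fl.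
pose fR u' : {linear V -> W} :=
  HB.pack (f u') (GRing.isLinear.Build F V W *:%R (f u') (fr u')).
pose fL v' : {linear U -> W} :=
  HB.pack (f^~ v') (GRing.isLinear.Build F U W *:%R (f^~ v') (fl v')).
have -> : f u v = fL v u by [].
rewrite [in RHS](coord_vbasis (memvf u)) linear_sum; apply: eq_bigr => i _.
rewrite linearZ /=.
have -> : f (vbasis {:U})`_i v = fR (vbasis {:U})`_i v by [].
rewrite [in RHS](coord_vbasis (memvf v)) linear_sum scaler_sumr.
by apply: eq_bigr => j _; rewrite linearZ /= scalerA mxE.
Qed.

Lemma tlift_sum U V W (f : U -> V -> W) n (a : 'I_n -> U) (b : 'I_n -> V) :
  bilinear_op f ->
  tlift f (\sum_i tens (a i) (b i)) = \sum_i f (a i) (b i).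
Proof.
move=> fb; pose g : {linear tensor U V -> W} :=
  HB.pack (tlift f)
    (GRing.isLinear.Build F (tensor U V) W *:%R (tlift f) (@tlift_linear _ _ _ f)).
have -> : tlift f (\sum_i tens (a i) (b i)) = g (\sum_i tens (a i) (b i)) by [].
by rewrite linear_sum; apply: eq_bigr => i _; apply: tlift_tens.
Qed.

Lemma tens_basis U V (t : tensor U V) :
  t = \sum_i \sum_j
        (t : 'M[F]__) i j *: tens (vbasis {:U})`_i (vbasis {:V})`_j.
Proof.
apply/matrixP => k l; rewrite summxE (bigD1 k) //= summxE (bigD1 l) //=.
have fU := basis_free (vbasisP {:U}); have fV := basis_free (vbasisP {:V}).
rewrite !mxE !coord_free // !eqxx !mulr1.
rewrite big1 ?addr0 => [|j /negPf njl]; last first.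
  by rewrite !mxE !coord_free // njl !mulr0.
rewrite big1 ?addr0 // => i /negPf nik.
rewrite summxE big1 // => j _.
by rewrite !mxE !coord_free // nik mul0r mulr0.
Qed.

Lemma tlift_unique U V W (f : U -> V -> W) (g : tensor U V -> W) :
  linear g -> (forall u v, g (tens u v) = f u v) -> g =1 tlift f.
Proof.
move=> gl gf t.
pose gL : {linear tensor U V -> W} :=
  HB.pack g (GRing.isLinear.Build F (tensor U V) W *:%R g gl).
have -> : g t = gL t by [].
rewrite {1}[t]tens_basis linear_sum; apply: eq_bigr => i _.
by rewrite linear_sum; apply: eq_bigr => j _; rewrite linearZ /= gf.
Qed.

End Tensor.

(* nw, ne, sw, se are the four arrows, named by compass direction. *)
Record quadri_ops (F : fieldType) (A : vectType F) := QuadriOps {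
  nw : A -> A -> A;
  ne : A -> A -> A;
  sw : A -> A -> A;
  se : A -> A -> A
}.

Section QuadriAlgebra.
Variables (F : fieldType) (A : vectType F) (Q : quadri_ops A).

Definition succ (x y : A) := ne Q x y + se Q x y.
Definition prec (x y : A) := nw Q x y + sw Q x y.
Definition vee (x y : A) := sw Q x y + se Q x y.
Definition wedge (x y : A) := nw Q x y + ne Q x y.
Definition star (x y : A) := nw Q x y + ne Q x y + sw Q x y + se Q x y.

Record is_quadri_algebra : Prop := IsQuadriAlgebra {
  nw_bilinear : bilinear_op (nw Q);
  ne_bilinear : bilinear_op (ne Q);
  sw_bilinear : bilinear_op (sw Q);
  se_bilinear : bilinear_op (se Q);
  nw_nw : forall x y z, nw Q (nw Q x y) z = nw Q x (star y z);
  ne_nw : forall x y z, nw Q (ne Q x y) z = ne Q x (prec y z);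
  wedge_ne : forall x y z, ne Q (wedge x y) z = ne Q x (succ y z);
  sw_nw : forall x y z, nw Q (sw Q x y) z = sw Q x (wedge y z);
  se_nw : forall x y z, nw Q (se Q x y) z = se Q x (nw Q y z);
  vee_ne : forall x y z, ne Q (vee x y) z = se Q x (ne Q y z);
  prec_sw : forall x y z, sw Q (prec x y) z = sw Q x (vee y z);
  succ_sw : forall x y z, sw Q (succ x y) z = se Q x (sw Q y z);
  star_se : forall x y z, se Q (star x y) z = se Q x (se Q y z)
}.

End QuadriAlgebra.


Record quadri_coops (F : fieldType) (A : vectType F) := QuadriCoops {
  co_a : A -> tensor A A;   (* alpha *)
  co_b : A -> tensor A A;   (* beta *)
  co_at : A -> tensor A A;  (* alpha tilde *)
  co_bt : A -> tensor A A   (* beta tilde *)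
}.

Section QuadriCoalgebra.
Variables (F : fieldType) (A : vectType F).

Definition dual : vectType F := 'Hom(A, F^o).

(* <a (x) b, t> for a, b in the dual of A. *)
Definition tpair (a b : dual) : tensor A A -> F^o :=
  tlift (fun x y => (a x * b y : F^o)).

(* d^*, with <d^*(a (x) b), x> = <a (x) b, d(x)>; meaningful for linear d
   only, since [linfun] requires a linear function. *)
Definition dual_op (d : A -> tensor A A) (a b : dual) : dual :=
  linfun (fun x : A => tpair a b (d x)).

Lemma tpair_tens a b x y : tpair a b (tens x y) = a x * b y.
Proof.
by apply: tlift_tens; split=> [u|v] k s t; rewrite linearP /=;
   [rewrite mulrDr mulrCA | rewrite mulrDl -mulrA].
Qed.

Lemma dual_opE (d : A -> tensor A A) (a b : dual) (x : A) :
  linear d -> dual_op d a b x = tpair a b (d x).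
Proof.
move=> dl; have fl : linear (fun x : A => tpair a b (d x)).
  by move=> k u v; rewrite dl /tpair tlift_linear.
pose f : {linear A -> F^o} :=
  HB.pack (fun x : A => tpair a b (d x))
    (GRing.isLinear.Build F A F^o *:%R (fun x : A => tpair a b (d x)) fl).
exact: (lfunE f x).
Qed.

Variable C : quadri_coops A.

Definition dual_ops : quadri_ops dual :=
  QuadriOps (dual_op (co_a C)) (dual_op (co_b C))
            (dual_op (co_at C)) (dual_op (co_bt C)).

Record is_quadri_coalgebra : Prop := IsQuadriCoalgebra {
  co_a_linear : linear (co_a C);
  co_b_linear : linear (co_b C);
  co_at_linear : linear (co_at C);
  co_bt_linear : linear (co_bt C);
  dual_quadri_algebra : is_quadri_algebra dual_ops
}.

End QuadriCoalgebra.

Definition Lop (T : Type) (op : T -> T -> T) (x : T) : T -> T := fun y => op x y.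
Definition Rop (T : Type) (op : T -> T -> T) (y : T) : T -> T := fun x => op x y.

Section QuadriBialgebra.
Variables (F : fieldType) (A : vectType F).
Variables (Q : quadri_ops A) (C : quadri_coops A).

Local Notation a := (co_a C).
Local Notation b := (co_b C).
Local Notation a' := (co_at C).
Local Notation b' := (co_bt C).
Local Notation nw := (nw Q).
Local Notation ne := (ne Q).
Local Notation sw := (sw Q).
Local Notation se := (se Q).
Local Notation succ := (succ Q).
Local Notation prec := (prec Q).
Local Notation vee := (vee Q).
Local Notation wedge := (wedge Q).
Local Notation star := (star Q).
Local Notation L1 op x := (tmapl (Lop op x)).
Local Notation R1 op x := (tmapl (Rop op x)).
Local Notation L2 op x := (tmapr (Lop op x)).
Local Notation R2 op x := (tmapr (Rop op x)).
Local Notation tau := (@flip F A A).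

Record is_quadri_bialgebra : Prop := IsQuadriBialgebra {
  bialg_algebra : is_quadri_algebra Q;
  bialg_coalgebra : is_quadri_coalgebra C;
  bialg1 : forall x y,
    a' (star x y) = R1 wedge y (a' x) + L2 succ x (a' y);
  bialg2 : forall x y,
    b (star x y) = R1 prec y (b x) + L2 vee x (b y);
  bialg3 : forall x y,
    b (wedge x y) + b' (wedge x y)
      = R1 nw y (b x + b' x) + L2 wedge x (b' y);
  bialg4 : forall x y,
    a (wedge x y) + a' (wedge x y)
      = R1 wedge y (a x + a' x) + L2 ne x (a' y);
  bialg5 : forall x y,
    b (vee x y) + b' (vee x y)
      = L2 vee x (b y + b' y) + R1 sw y (b x);
  bialg6 : forall x y,
    a (vee x y) + a' (vee x y)
      = L2 se x (a y + a' y) + R1 vee y (a x);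
  bialg7 : forall x y,
    a (succ x y) + b (succ x y)
      = L2 se x (a y + b y) + R1 succ y (a x);
  bialg8 : forall x y,
    a' (succ x y) + b' (succ x y)
      = L2 succ x (a' y + b' y) + R1 ne y (a' x);
  bialg9 : forall x y,
    a (prec x y) + b (prec x y)
      = R1 prec y (a x + b x) + L2 sw x (b y);
  bialg10 : forall x y,
    a' (prec x y) + b' (prec x y)
      = R1 nw y (a' x + b' x) + L2 prec x (b' y);
  bialg11 : forall x y,
    L2 succ y (tau (b x)) - R1 wedge y (tau (b x))
      = R2 prec x (a' y) - L1 vee x (a' y);
  bialg12 : forall x y,
    R2 nw x (a y + a' y) - L1 vee x (a y + a' y)
      = L2 ne y (tau (b x)) - R1 vee y (tau (b' x));
  bialg13 : forall x y,
    R1 wedge y (tau (b x) + tau (b' x)) - L2 se y (tau (b x) + tau (b' x))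
      = L1 wedge x (a y) - R2 sw x (a' y);
  bialg14 : forall x y,
    L2 succ x (tau (a y) + tau (b y)) - R1 nw x (tau (a y) + tau (b y))
      = R2 succ y (b' x) - L1 sw y (a' x);
  bialg15 : forall x y,
    L2 se x (tau (a' y) + tau (b' y)) - R1 prec x (tau (a' y) + tau (b' y))
      = R2 ne y (b x) - L1 prec y (a x);
  bialg16 : forall x y,
    a (sw x y) + a' (sw x y) + b (sw x y) + b' (sw x y)
      = R1 sw y (a x + b x) + L2 sw x (b y + b' y);
  bialg17 : forall x y,
    a (ne x y) + b (ne x y) + a' (ne x y) + b' (ne x y)
      = R1 ne y (a x + a' x) + L2 ne x (a' y + b' y);
  bialg18 : forall x y,
    L1 sw y (a x + a' x) + L2 ne x (tau (a y) + tau (b y))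
      = R1 sw x (tau (a' y) + tau (b' y)) + R2 ne y (b x + b' x)
}.

End QuadriBialgebra.

Section Coboundary.
Variables (F : fieldType) (A : vectType F).
Variables (Q : quadri_ops A) (r : tensor A A).

Definition r_coops : quadri_coops A :=
  QuadriCoops
    (fun x => - tmapr (Lop (se Q) x) r + tmapl (Rop (star Q) x) r)
    (fun x => tmapr (Lop (vee Q) x) r - tmapl (Rop (prec Q) x) r)
    (fun x => tmapr (Lop (succ Q) x) r - tmapl (Rop (wedge Q) x) r)
    (fun x => - tmapr (Lop (star Q) x) r + tmapl (Rop (nw Q) x) r).

Definition tensor3 : vectType F := tensor A (tensor A A).

(* [r12_13 op] is r_12 op r_13, etc.; for r = \sum_i a_i (x) b_i, the outer
   [tlift] runs over the left factor and the inner one over the right factor. *)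
Definition r12_13 (op : A -> A -> A) : tensor3 :=
  tlift (fun ai bi =>
    tlift (fun aj bj => tens (op ai aj) (tens bi bj)) r) r.
Definition r13_23 (op : A -> A -> A) : tensor3 :=
  tlift (fun ai bi =>
    tlift (fun aj bj => tens ai (tens aj (op bi bj))) r) r.
Definition r23_12 (op : A -> A -> A) : tensor3 :=
  tlift (fun ai bi =>
    tlift (fun aj bj => tens aj (tens (op ai bj) bi)) r) r.

(* [Qij] is Q_i^j. *)
Definition Q11 : tensor3 :=
  r23_12 (wedge Q) - r13_23 (succ Q) + r12_13 (sw Q).
Definition Q12 : tensor3 :=
  r23_12 (vee Q) - r12_13 (prec Q) + r13_23 (ne Q).
Definition Q21 : tensor3 :=
  r12_13 (wedge Q) - r23_12 (succ Q) - r13_23 (sw Q).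
Definition Q22 : tensor3 :=
  r12_13 (vee Q) + r13_23 (prec Q) + r23_12 (ne Q).
Definition Q31 : tensor3 :=
  r13_23 (wedge Q) + r12_13 (succ Q) + r23_12 (sw Q).
Definition Q32 : tensor3 :=
  r13_23 (vee Q) - r23_12 (prec Q) - r12_13 (ne Q).

(* (1 (x) 1 (x) L_opl(x) - R_opr(x) (x) 1 (x) 1) t *)
Definition LRdiff (opl opr : A -> A -> A) (x : A) (t : tensor3) : tensor3 :=
  tmap3 id id (Lop opl x) t - tmap3 (Rop opr x) id id t.

End Coboundary.

(* Main.v *)
(* Testing tensors against linear functionals p, q, s turns every equation into
   one between sums over r, or over r (x) r, of products of scalars such as
   p(u) q(v); it then suffices to compare summands, which are normalised by
   reading the quadri-algebra axioms as rewriting rules.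
   The eighteen compatibility conditions hold for every skew-symmetric r, the
   skew-symmetry being needed only to remove the flips.  The k-th axiom of the
   dual quadri-algebra, evaluated at x, is up to sign the pairing of
   p (x) q (x) s with the k-th of the nine expressions. *)
From HB Require Import structures.
Require Import Defs.
From mathcomp Require Import all_boot all_order all_algebra.
From mathcomp Require Import ring.

Set Implicit Arguments.
Unset Strict Implicit.
Unset Printing Implicit Defensive.

Import GRing.Theory.
Local Open Scope ring_scope.

(** * Pairing tensors with linear functionals *)

Section TensorPairing.
Variable F : fieldType.
Implicit Types U V W : vectType F.

Lemma eq_tlift U V W (f g : U -> V -> W) (t : tensor U V) :
  f =2 g -> tlift f t = tlift g t.
Proof.
by move=> fg; apply: eq_bigr => i _; apply: eq_bigr => j _; rewrite fg.
Qed.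

Lemma tliftD U V W (f g : U -> V -> W) (t : tensor U V) :
  tlift (fun u v => f u v + g u v) t = tlift f t + tlift g t.
Proof.
rewrite /tlift -big_split; apply: eq_bigr => i _; rewrite -big_split.
by apply: eq_bigr => j _; rewrite scalerDr.
Qed.

Lemma linear_tlift U V W W' (h : W -> W') (f : U -> V -> W) (t : tensor U V) :
  linear h -> h (tlift f t) = tlift (fun u v => h (f u v)) t.
Proof.
move=> hl; pose hL : {linear W -> W'} :=
  HB.pack h (GRing.isLinear.Build F W W' *:%R h hl).
rewrite -[h]/(hL : W -> W') linear_sum; apply: eq_bigr => i _.
by rewrite linear_sum; apply: eq_bigr => j _; rewrite linearZ.
Qed.

Lemma tliftN U V W (f : U -> V -> W) (t : tensor U V) :
  tlift (fun u v => - f u v) t = - tlift f t.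
Proof.
by rewrite (linear_tlift (h := -%R)) // => k x y; rewrite opprD scalerN.
Qed.

Lemma tlift_mulr U V (f : U -> V -> F^o) (c : F^o) (t : tensor U V) :
  tlift f t * c = tlift (fun u v => f u v * c : F^o) t.
Proof.
rewrite (linear_tlift (h := fun x : F^o => (x * c : F^o))) // => k x y.
by rewrite mulrDl scalerAl.
Qed.

Lemma tlift_mull U V (f : U -> V -> F^o) (c : F^o) (t : tensor U V) :
  c * tlift f t = tlift (fun u v => c * f u v : F^o) t.
Proof.
rewrite (linear_tlift (h := fun x : F^o => (c * x : F^o))) // => k x y.
by rewrite mulrDr scalerAr.
Qed.

(** Fubini for finite sums over two tensors; it lets the two copies of [r] in a double sum trade
    places. *)
Lemma tlift_exchange U V U' V' W (f : U -> V -> U' -> V' -> W)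
    (s : tensor U V) (t : tensor U' V') :
  tlift (fun u v => tlift (f u v) t) s
    = tlift (fun u' v' => tlift (fun u v => f u v u' v') s) t.
Proof.
rewrite /tlift.
under eq_bigr do under eq_bigr do rewrite scaler_sumr.
under [RHS]eq_bigr do under eq_bigr do rewrite scaler_sumr.
under eq_bigr do rewrite exchange_big.
rewrite exchange_big; apply: eq_bigr => i' _.
under eq_bigr do under eq_bigr do rewrite scaler_sumr.
under [RHS]eq_bigr do under eq_bigr do rewrite scaler_sumr.
under eq_bigr do rewrite exchange_big.
rewrite exchange_big; apply: eq_bigr => j' _.
apply: eq_bigr => i _; apply: eq_bigr => j _.
by rewrite !scalerA mulrC.
Qed.

(** The functionals are plain functions, with linearity as a separate hypothesis, so that a map
    acting on a leg is absorbed into the functional without repacking it. *)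
Definition pair2 U V (p : U -> F^o) (q : V -> F^o) : tensor U V -> F^o :=
  tlift (fun u v => (p u * q v : F^o)).

Lemma pair2_tens U V (p : U -> F^o) (q : V -> F^o) u v :
  linear p -> linear q -> pair2 p q (tens u v) = p u * q v.
Proof.
move=> pl ql; apply: tlift_tens; split=> [u'|v'] k x y.
  by rewrite ql mulrDr scalerAr.
by rewrite pl mulrDl scalerAl.
Qed.

Lemma pair2D U V (p : U -> F^o) (q : V -> F^o) t t' :
  pair2 p q (t + t') = pair2 p q t + pair2 p q t'.
Proof. by rewrite -[t]scale1r /pair2 tlift_linear !scale1r. Qed.

Lemma pair2N U V (p : U -> F^o) (q : V -> F^o) t :
  pair2 p q (- t) = - pair2 p q t.
Proof.
by apply/eqP; rewrite -addr_eq0 -pair2D addNr /pair2 /tlift; rewrite big1 // =>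
  i _; rewrite big1 // => j _; rewrite mxE scale0r.
Qed.

Lemma pair2_tmap U U' V V' (p : U' -> F^o) (q : V' -> F^o)
    (f : U -> U') (g : V -> V') t :
  linear p -> linear q -> pair2 p q (tmap f g t) = pair2 (p \o f) (q \o g) t.
Proof.
move=> pl ql; rewrite [LHS]linear_tlift; last exact: tlift_linear.
by apply: eq_tlift => u v; apply: pair2_tens.
Qed.

(** Pairing with the [i]-th and [j]-th coordinate functionals of the chosen bases returns the entry
    [t i j]. *)
Lemma tensor_eq0 U V (t : tensor U V) :
  (forall (p : U -> F^o) (q : V -> F^o), linear p -> linear q ->
     pair2 p q t = 0) -> t = 0.
Proof.
move=> t0; apply/matrixP => i j; rewrite mxE.
rewrite -(t0 (coord (vbasis {:U}) i) (coord (vbasis {:V}) j)); last 2 first.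
- by move=> k x y; rewrite linearP.
- by move=> k x y; rewrite linearP.
have fU := basis_free (vbasisP {:U}); have fV := basis_free (vbasisP {:V}).
rewrite /pair2 /tlift (bigD1 i) //= (bigD1 j) //= !coord_free // !eqxx.
rewrite mul1r [X in _ = (_ + X) + _]big1 ?addr0 => [|l /negPf nlj]; last first.
  by rewrite coord_free // nlj mulr0 scaler0.
rewrite big1 ?addr0 => [|k /negPf nki]; first by rewrite /GRing.scale /= mulr1.
by rewrite big1 // => l _; rewrite (coord_free _ _ fU) nki mul0r scaler0.
Qed.

Lemma tensor_eq U V (t t' : tensor U V) :
  (forall (p : U -> F^o) (q : V -> F^o), linear p -> linear q ->
     pair2 p q t = pair2 p q t') -> t = t'.
Proof.
move=> tt'; apply/eqP; rewrite -subr_eq0; apply/eqP; apply: tensor_eq0.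
by move=> p q pl ql; rewrite pair2D pair2N tt' // subrr.
Qed.

Lemma pair2_tmapl U U' V (p : U' -> F^o) (q : V -> F^o) (f : U -> U')
    (t : tensor U V) :
  linear p -> linear q -> pair2 p q (tmapl f t) = pair2 (fun u => p (f u)) q t.
Proof. exact: pair2_tmap. Qed.

Lemma pair2_tmapr U V V' (p : U -> F^o) (q : V' -> F^o) (g : V -> V')
    (t : tensor U V) :
  linear p -> linear q -> pair2 p q (tmapr g t) = pair2 p (fun v => q (g v)) t.
Proof. exact: pair2_tmap. Qed.

Lemma linear_comp U V W (f : V -> W) (g : U -> V) :
  linear f -> linear g -> linear (fun u => f (g u)).
Proof. by move=> fl gl k x y; rewrite gl fl. Qed.

Lemma pair2_flip U V (p : V -> F^o) (q : U -> F^o) (t : tensor U V) :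
  linear p -> linear q -> pair2 p q (flip t) = pair2 q p t.
Proof.
move=> pl ql; rewrite [LHS]linear_tlift; last exact: tlift_linear.
by apply: eq_tlift => u v; rewrite [LHS]pair2_tens // mulrC.
Qed.

Lemma flipD U V (s t : tensor U V) : flip (s + t) = flip s + flip t.
Proof. by rewrite -[s]scale1r /flip tlift_linear !scale1r. Qed.

Lemma flip_tmap U U' V V' (f : U -> U') (g : V -> V') (t : tensor U V) :
  linear f -> linear g -> flip (tmap f g t) = tmap g f (flip t).
Proof.
move=> fl gl; apply: tensor_eq => p q pl ql.
rewrite pair2_flip // !pair2_tmap // pair2_flip //; exact: linear_comp.
Qed.

Lemma flipN U V (t : tensor U V) : flip (- t) = - flip t.
Proof.
by apply: tensor_eq => p q pl ql; rewrite pair2_flip // !pair2N pair2_flip.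
Qed.

Definition pair3 U V W (p : U -> F^o) (q : V -> F^o) (s : W -> F^o) :
    tensor U (tensor V W) -> F^o :=
  pair2 p (pair2 q s).

Lemma pair2_linear U V (p : U -> F^o) (q : V -> F^o) : linear (pair2 p q).
Proof. exact: tlift_linear. Qed.

Lemma pair3_tens U V W (p : U -> F^o) (q : V -> F^o) (s : W -> F^o) u v w :
  linear p -> linear q -> linear s ->
  pair3 p q s (tens u (tens v w)) = p u * (q v * s w).
Proof.
move=> pl ql sl; rewrite /pair3 !pair2_tens //; exact: pair2_linear.
Qed.

Lemma pair3_tmap3 U U' V V' W W' (p : U' -> F^o) (q : V' -> F^o)
    (s : W' -> F^o) (f : U -> U') (g : V -> V') (h : W -> W') t :
  linear p -> linear q -> linear s ->
  pair3 p q s (tmap3 f g h t) = pair3 (p \o f) (q \o g) (s \o h) t.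
Proof.
move=> pl ql sl; rewrite /pair3 pair2_tmap //; last exact: pair2_linear.
by apply: eq_tlift => u v /=; rewrite pair2_tmap.
Qed.

(** A functional [x] on [tensor V W] need not have the form [pair2 q s]. Contracting the first leg
    with [p] gives [pt] in [tensor V W], which vanishes by [tensor_eq0]; hence
    [pair2 p x t = x pt = 0] for every linear [x]. *)
Lemma tensor3_eq0 U V W (t : tensor U (tensor V W)) :
  (forall (p : U -> F^o) (q : V -> F^o) (s : W -> F^o),
     linear p -> linear q -> linear s -> pair3 p q s t = 0) -> t = 0.
Proof.
move=> t0; apply: tensor_eq0 => p x pl xl.
pose pt := tlift (fun u w => p u *: w) t.
have ptE y : linear y -> pair2 p y t = y pt.
  move=> yl; rewrite [RHS]linear_tlift //; apply: eq_tlift => u w.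
  pose yL : {linear tensor V W -> F^o} :=
    HB.pack y (GRing.isLinear.Build F (tensor V W) F^o *:%R y yl).
  by rewrite -[y]/(yL : tensor V W -> F^o) linearZ.
have -> : pair2 p x t = x pt by exact: ptE.
have -> : pt = 0.
  apply: tensor_eq0 => q s ql sl; rewrite -ptE; last exact: pair2_linear.
  exact: t0.
pose xL : {linear tensor V W -> F^o} :=
  HB.pack x (GRing.isLinear.Build F (tensor V W) F^o *:%R x xl).
by rewrite -[x]/(xL : tensor V W -> F^o) linear0.
Qed.

End TensorPairing.

(** * Expansion rules from bilinearity and from the quadri-algebra axioms *)

Lemma linearDN (F : fieldType) (V W : lmodType F) (f : V -> W) :
  linear f ->
  (forall x y, f (x + y) = f x + f y) * (forall x, f (- x) = - f x).
Proof.
move=> fl; pose fL : {linear V -> W} :=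
  HB.pack f (GRing.isLinear.Build F V W *:%R f fl).
by split=> [x y|x]; rewrite -[f]/(fL : V -> W) (linearD, linearN).
Qed.

Lemma bilinear_opDN (F : fieldType) (U V W : vectType F) (f : U -> V -> W) :
  bilinear_op f ->
  ((forall x y z, f (x + y) z = f x z + f y z) *
   (forall x z, f (- x) z = - f x z)) *
  ((forall x y z, f x (y + z) = f x y + f x z) *
   (forall x y, f x (- y) = - f x y)).
Proof.
case=> fr fl; split; split=> [x y z|x y].
- exact: (linearDN (fl z)).1.
- exact: (linearDN (fl y)).2.
- exact: (linearDN (fr x)).1.
- exact: (linearDN (fr x)).2.
Qed.

Section Quadri.
Variables (F : fieldType) (A : vectType F) (Q : quadri_ops A).
Hypothesis hQ : is_quadri_algebra Q.

(** An axiom whose left factor is a derived operation expands into several monomials. This lemma and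
    the next four isolate one of them, chosen so that it is the left side of no other rule and
    recurs on no right side. *)
Lemma ne_nw_ne x y z :
  ne Q (nw Q x y) z = ne Q x (succ Q y z) - ne Q (ne Q x y) z.
Proof.
by rewrite -(wedge_ne hQ) (bilinear_opDN (ne_bilinear hQ)) addrK.
Qed.

Lemma ne_sw_ne x y z :
  ne Q (sw Q x y) z = se Q x (ne Q y z) - ne Q (se Q x y) z.
Proof.
by rewrite -(vee_ne hQ) (bilinear_opDN (ne_bilinear hQ)) addrK.
Qed.

Lemma sw_nw_sw x y z :
  sw Q (nw Q x y) z = sw Q x (vee Q y z) - sw Q (sw Q x y) z.
Proof.
by rewrite -(prec_sw hQ) (bilinear_opDN (sw_bilinear hQ)) addrK.
Qed.

Lemma sw_ne_sw x y z :
  sw Q (ne Q x y) z = se Q x (sw Q y z) - sw Q (se Q x y) z.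
Proof.
by rewrite -(succ_sw hQ) (bilinear_opDN (sw_bilinear hQ)) addrK.
Qed.

Lemma se_nw_se x y z :
  se Q (nw Q x y) z = se Q x (se Q y z)
    - (se Q (ne Q x y) z + se Q (sw Q x y) z + se Q (se Q x y) z).
Proof.
rewrite -(star_se hQ) /star !(bilinear_opDN (se_bilinear hQ)).
by apply/eqP; rewrite eq_sym subr_eq !addrA.
Qed.

Definition quadri_bilinE :=
  (bilinear_opDN (nw_bilinear hQ), bilinear_opDN (ne_bilinear hQ),
   bilinear_opDN (sw_bilinear hQ), bilinear_opDN (se_bilinear hQ)).

(* The axioms, solved for nine distinct monomials [(x * y) * z]: together they
   rewrite every product of three elements to a normal form. *)
Definition quadri_assocE :=
  (nw_nw hQ, ne_nw hQ, sw_nw hQ, se_nw hQ,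
   ne_nw_ne, ne_sw_ne, sw_nw_sw, sw_ne_sw, se_nw_se).

Lemma bilinear_opD (f g : A -> A -> A) :
  bilinear_op f -> bilinear_op g -> bilinear_op (fun x y => f x y + g x y).
Proof.
by move=> [fr fl] [gr gl]; split=> [u|v] k x y;
  rewrite ?fr ?gr ?fl ?gl scalerDr addrACA.
Qed.

Lemma succ_bilinear : bilinear_op (succ Q).
Proof. exact: bilinear_opD (ne_bilinear hQ) (se_bilinear hQ). Qed.

Lemma prec_bilinear : bilinear_op (prec Q).
Proof. exact: bilinear_opD (nw_bilinear hQ) (sw_bilinear hQ). Qed.

Lemma vee_bilinear : bilinear_op (vee Q).
Proof. exact: bilinear_opD (sw_bilinear hQ) (se_bilinear hQ). Qed.

Lemma wedge_bilinear : bilinear_op (wedge Q).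
Proof. exact: bilinear_opD (nw_bilinear hQ) (ne_bilinear hQ). Qed.

Lemma star_bilinear : bilinear_op (star Q).
Proof.
apply: bilinear_opD (se_bilinear hQ); apply: bilinear_opD (sw_bilinear hQ).
exact: wedge_bilinear.
Qed.

End Quadri.

(** * Automation for linearity goals and normal forms *)

Lemma linear_Lop (F : fieldType) (A : vectType F) (f : A -> A -> A) x :
  bilinear_op f -> linear (Lop f x).
Proof. by case=> + _; apply. Qed.

Lemma linear_Rop (F : fieldType) (A : vectType F) (f : A -> A -> A) x :
  bilinear_op f -> linear (Rop f x).
Proof. by case=> _; apply. Qed.

Create HintDb quadri.
#[export] Hint Resolve nw_bilinear ne_bilinear sw_bilinear se_bilinear
  succ_bilinear prec_bilinear vee_bilinear wedge_bilinear star_bilinear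
  linear_Lop linear_Rop linear_comp : quadri.

(** The second branch names both factors of a composite functional for [linear_comp] instead of
    leaving them to higher-order unification. *)
Ltac quadri_linear :=
  solve [ auto with quadri
        | match goal with
          | |- linear (fun u => ?p (@?f u)) =>
              apply: (@linear_comp _ _ _ _ p f); auto with quadri
          end ].

(* A second expansion is needed: the right-hand sides of the axioms contain the
   derived operations again. *)
Ltac quadri_normalize hQ :=
  rewrite /Lop /Rop /succ /prec /vee /wedge /star;
  rewrite ?(quadri_bilinE hQ) ?(quadri_assocE hQ);
  rewrite /succ /prec /vee /wedge /star ?(quadri_bilinE hQ).

(** * The eighteen compatibility conditions for a skew-symmetric [r] *)

Section Coboundary.
Variables (F : fieldType) (A : vectType F) (Q : quadri_ops A).
Hypothesis hQ : is_quadri_algebra Q.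
Variable r : tensor A A.
Hypothesis hr : skew_symmetric r.

(** The flip carries [f] to the other leg and then acts on [r] itself, where skew-symmetry turns it
    into a sign. *)
Lemma flip_tmapl_skew (f : A -> A) :
  linear f -> flip (tmapl f r) = - tmapr f r.
Proof.
move=> fl; rewrite flip_tmap //.
rewrite hr; apply: tensor_eq => p q pl ql.
by rewrite pair2N !pair2_tmap // pair2N.
Qed.

Lemma flip_tmapr_skew (f : A -> A) :
  linear f -> flip (tmapr f r) = - tmapl f r.
Proof.
move=> fl; rewrite flip_tmap //.
rewrite hr; apply: tensor_eq => p q pl ql.
by rewrite pair2N !pair2_tmap // pair2N.
Qed.

(** Once maps and flips are absorbed, each side is gathered into a single sum over [r], and the
    summands in [u], [v] are compared in normal form. *)
Ltac to_scalars pl ql :=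
  repeat first
    [ rewrite pair2D | rewrite pair2N
    | rewrite flipD | rewrite flipN
    | rewrite flip_tmapl_skew; [|quadri_linear]
    | rewrite flip_tmapr_skew; [|quadri_linear]
    | rewrite pair2_tmapl; [|quadri_linear|quadri_linear]
    | rewrite pair2_tmapr; [|quadri_linear|quadri_linear] ];
  rewrite /pair2 -?(tliftN, tliftD); apply: eq_tlift => u v /=;
  quadri_normalize hQ; rewrite ?(linearDN pl) ?(linearDN ql); ring.

(** Each condition is linear in [r], so after pairing every functional is applied to a product of
    one leg of [r] with at most [x] and [y]: the normal form for three factors decides it. The
    algebra and coalgebra fields come from [hQ] and [hC]. *)
Lemma r_coops_bialgebra :
  is_quadri_coalgebra (r_coops Q r) -> is_quadri_bialgebra Q (r_coops Q r).
Proof.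
move=> hC; split=> //= x y; apply: tensor_eq => p q pl ql.
all: to_scalars pl ql.
Qed.
End Coboundary.

(** * Operations on the dual induced by coboundary co-operations *)

Lemma tlift_param_linear (F : fieldType) (U V W X : vectType F)
    (f : X -> U -> V -> W) (t : tensor U V) :
  (forall u v, linear (fun x => f x u v)) -> linear (fun x => tlift (f x) t).
Proof.
move=> fl k x y; rewrite (linear_tlift (h := *:%R k)); last first.
  by move=> c u v; rewrite scalerDr !scalerA mulrC.
by rewrite -tliftD; apply: eq_tlift => u v; apply: fl.
Qed.

Lemma dual_linear (F : fieldType) (A : vectType F) (p : dual A) :
  linear (p : A -> F^o).
Proof. by move=> k x y; rewrite linearP. Qed.

Section DualOperations.
Variables (F : fieldType) (A : vectType F) (r : tensor A A).

Lemma cobr_linear (f : A -> A -> A) :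
  bilinear_op f -> linear (fun x => tmapr (Lop f x) r).
Proof.
move=> [_ fl]; apply: tlift_param_linear => u v.
exact: (linear_comp ((tens_bilinear A A).1 u) (fl v)).
Qed.

Lemma cobl_linear (f : A -> A -> A) :
  bilinear_op f -> linear (fun x => tmapl (Rop f x) r).
Proof.
move=> [fr _]; apply: tlift_param_linear => u v.
exact: (linear_comp ((tens_bilinear A A).2 v) (fr u)).
Qed.

Lemma dual_op_bilinear (d : A -> tensor A A) :
  linear d -> bilinear_op (dual_op d).
Proof.
move=> dl; split=> [a|b] k x y; apply/lfunP => z;
  rewrite add_lfunE scale_lfunE !dual_opE //.
  suff pl : linear (fun b => tpair a b (d z)) by exact: pl.
  by apply: tlift_param_linear => u v c b b'; rewrite add_lfunE scale_lfunE
    mulrDr scalerAr.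
suff pl : linear (fun a => tpair a b (d z)) by exact: pl.
by apply: tlift_param_linear => u v c a a'; rewrite add_lfunE scale_lfunE
  mulrDl scalerAl.
Qed.

(* [o] is dual to the co-operation [x |-> (1 (x) L_l(x) - R_m(x) (x) 1) r]. *)
Definition coboundary_dual (l m : A -> A -> A) (o : dual A -> dual A -> dual A)
    : Prop :=
  forall p q x, o p q x =
    tlift (fun u v => p u * q (l x v) - p (m u x) * q v : F^o) r.

(** Since [l] and [m] add along with [o], the derived operations of the dual have the same shape as
    its four arrows. *)
Lemma coboundary_dualD l m o l' m' o' :
  coboundary_dual l m o -> coboundary_dual l' m' o' ->
  coboundary_dual (fun x y => l x y + l' x y) (fun x y => m x y + m' x y)
    (fun p q => o p q + o' p q).
Proof.
move=> ho ho' p q x; rewrite add_lfunE ho ho' -tliftD; apply: eq_tlift => u v.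
by rewrite !linearD /= mulrDl mulrDr opprD addrACA.
Qed.

(* The first double sum is exchanged so that, in both terms and in all six
   [Q_i^j], the leg carrying two factors of [r] always sees them as [u, u'],
   [u', v] or [v, v']: the comparison is then termwise. *)
Lemma coboundary_dual_assoc l1 m1 o1 l2 m2 o2 l3 m3 o3 l4 m4 o4 :
  coboundary_dual l1 m1 o1 -> coboundary_dual l2 m2 o2 ->
  coboundary_dual l3 m3 o3 -> coboundary_dual l4 m4 o4 ->
  forall p q s x,
  o2 (o1 p q) s x - o3 p (o4 q s) x =
  tlift (fun u v => tlift (fun u' v' =>
    (p u * q (l1 u' v) - p (m1 u u') * q v) * s (l2 x v')
    - (p u * q (l1 (m2 u' x) v) - p (m1 u (m2 u' x)) * q v) * s v'
    - (p u * (q u' * s (l4 (l3 x v) v') - q (m4 u' (l3 x v)) * s v')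
       - p (m3 u x) * (q u' * s (l4 v v') - q (m4 u' v) * s v')) : F^o) r) r.
Proof.
move=> h1 h2 h3 h4 p q s x.
have -> : o2 (o1 p q) s x = tlift (fun u v => tlift (fun u' v' =>
    (p u * q (l1 u' v) - p (m1 u u') * q v) * s (l2 x v')
    - (p u * q (l1 (m2 u' x) v) - p (m1 u (m2 u' x)) * q v) * s v' : F^o) r) r.
  rewrite h2 tlift_exchange; apply: eq_tlift => u' v'.
  by rewrite !h1 !tlift_mulr -tliftN -tliftD.
rewrite h3 -tliftN -tliftD; apply: eq_tlift => u v.
by rewrite !h4 !tlift_mull -?(tliftN, tliftD).
Qed.

Variables (p q s : A -> F^o).
Hypotheses (pl : linear p) (ql : linear q) (sl : linear s).

Lemma pair3D (t t' : tensor3 A) :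
  pair3 p q s (t + t') = pair3 p q s t + pair3 p q s t'.
Proof. exact: pair2D. Qed.

Lemma pair3N (t : tensor3 A) : pair3 p q s (- t) = - pair3 p q s t.
Proof. exact: pair2N. Qed.

Lemma pair3_LRdiff (f g : A -> A -> A) x (t : tensor3 A) :
  pair3 p q s (LRdiff f g x t) =
  pair3 p q (fun w => s (Lop f x w)) t
    - pair3 (fun u => p (Rop g x u)) q s t.
Proof. by rewrite pair3D pair3N !pair3_tmap3. Qed.

Lemma pair3_r12_13 op :
  pair3 p q s (r12_13 r op) = tlift (fun u v => tlift (fun u' v' =>
    p (op u u') * (q v * s v') : F^o) r) r.
Proof.
rewrite [LHS]linear_tlift; last exact: pair2_linear.
apply: eq_tlift => u v; rewrite [LHS]linear_tlift; last exact: pair2_linear.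
by apply: eq_tlift => u' v'; rewrite [LHS]pair3_tens.
Qed.

Lemma pair3_r13_23 op :
  pair3 p q s (r13_23 r op) = tlift (fun u v => tlift (fun u' v' =>
    p u * (q u' * s (op v v')) : F^o) r) r.
Proof.
rewrite [LHS]linear_tlift; last exact: pair2_linear.
apply: eq_tlift => u v; rewrite [LHS]linear_tlift; last exact: pair2_linear.
by apply: eq_tlift => u' v'; rewrite [LHS]pair3_tens.
Qed.

Lemma pair3_r23_12 op :
  pair3 p q s (r23_12 r op) = tlift (fun u v => tlift (fun u' v' =>
    p u * (q (op u' v) * s v') : F^o) r) r.
Proof.
(* In [r23_12] the outer copy of [r] supplies the pair that the statement calls [u'], [v']; the
   exchange aligns the two orders of summation. *)
rewrite tlift_exchange.
rewrite [LHS]linear_tlift; last exact: pair2_linear.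
apply: eq_tlift => u v; rewrite [LHS]linear_tlift; last exact: pair2_linear.
by apply: eq_tlift => u' v'; rewrite [LHS]pair3_tens.
Qed.

End DualOperations.

#[export] Hint Resolve dual_linear : quadri.

(** Bridges plain linear functions and the bundled elements of [dual A] over which the dual axioms
    quantify. *)
Lemma tensor3_eq0_dual (F : fieldType) (A : vectType F) (t : tensor3 A) :
  (forall p q s : dual A, pair3 p q s t = 0) -> t = 0.
Proof.
move=> t0; apply: tensor3_eq0 => p q s pl ql sl.
pose lin (f : A -> F^o) (fl : linear f) : {linear A -> F^o} :=
  HB.pack f (GRing.isLinear.Build F A F^o *:%R f fl).
have linE f (fl : linear f) x : linfun (lin f fl) x = f x by rewrite lfunE.
rewrite -[RHS](t0 (linfun (lin p pl)) (linfun (lin q ql)) (linfun (lin s sl))).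
apply: eq_tlift => u v; rewrite linE; congr (_ * _).
by apply: eq_tlift => u' v'; rewrite !linE.
Qed.

(** Functionals are compared at every [x] and tensors on all triples of functionals, so both sides
    say that the same scalars vanish, up to the invertible factor [c]. *)
Lemma dual_eq_iff (F : fieldType) (A : vectType F) (c : F^o)
    (f g : dual A -> dual A -> dual A -> dual A) (E : A -> tensor3 A) :
  c != 0 ->
  (forall p q s x, f p q s x - g p q s x = c * pair3 p q s (E x)) ->
  (forall p q s, f p q s = g p q s) <-> (forall x, E x = 0).
Proof.
move=> c0 fgE; split=> [fg x|E0 p q s].
  apply: tensor3_eq0_dual => p q s; apply: (mulfI c0).
  by rewrite -fgE fg subrr mulr0.
apply/lfunP => x; apply/eqP; rewrite -subr_eq0 fgE E0.
(* Writing [0] as [0 - 0] makes its pairing vanish by additivity. *)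
by rewrite -(subrr (0 : tensor3 A)) pair3D pair3N subrr mulr0.
Qed.

(** * The nine axioms of the dual as equations in the [Q_i^j] *)

Section DualCoboundary.
Variables (F : fieldType) (A : vectType F) (Q : quadri_ops A).
Hypothesis hQ : is_quadri_algebra Q.
Variable r : tensor A A.
Local Notation D := (dual_ops (r_coops Q r)).

Lemma co_a_r_linear : linear (co_a (r_coops Q r)).
Proof.
move=> k x y /=.
rewrite (cobr_linear r (se_bilinear hQ)) (cobl_linear r (star_bilinear hQ)).
by rewrite opprD addrACA scalerDr scalerN.
Qed.

Lemma co_b_r_linear : linear (co_b (r_coops Q r)).
Proof.
move=> k x y /=.
rewrite (cobr_linear r (vee_bilinear hQ)) (cobl_linear r (prec_bilinear hQ)).
by rewrite opprD addrACA scalerDr scalerN.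
Qed.

Lemma co_at_r_linear : linear (co_at (r_coops Q r)).
Proof.
move=> k x y /=.
rewrite (cobr_linear r (succ_bilinear hQ)) (cobl_linear r (wedge_bilinear hQ)).
by rewrite opprD addrACA scalerDr scalerN.
Qed.

Lemma co_bt_r_linear : linear (co_bt (r_coops Q r)).
Proof.
move=> k x y /=.
rewrite (cobr_linear r (star_bilinear hQ)) (cobl_linear r (nw_bilinear hQ)).
by rewrite opprD addrACA scalerDr scalerN.
Qed.

Ltac dual_op_coboundary :=
  rewrite -[tpair _ _ _]/(pair2 _ _ _) ?(pair2D, pair2N);
  rewrite pair2_tmapr; [|exact: dual_linear|exact: dual_linear];
  rewrite pair2_tmapl; [|exact: dual_linear|exact: dual_linear];
  rewrite /pair2 -?(tliftN, tliftD); apply: eq_tlift => u v;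
  rewrite /Lop /Rop ?linearN; ring.

(** [co_a] and [co_bt] have the sign opposite to that of the shape in [coboundary_dual], hence the
    negated [l] and [m] here and in [se_dual]. *)
Lemma nw_dual :
  coboundary_dual r (fun x y => - se Q x y) (fun x y => - star Q x y) (nw D).
Proof.
move=> p q x; rewrite [LHS]dual_opE; last exact: co_a_r_linear.
dual_op_coboundary.
Qed.

Lemma ne_dual : coboundary_dual r (vee Q) (prec Q) (ne D).
Proof.
move=> p q x; rewrite [LHS]dual_opE; last exact: co_b_r_linear.
dual_op_coboundary.
Qed.

Lemma sw_dual : coboundary_dual r (succ Q) (wedge Q) (sw D).
Proof.
move=> p q x; rewrite [LHS]dual_opE; last exact: co_at_r_linear.
dual_op_coboundary.
Qed.

Lemma se_dual :
  coboundary_dual r (fun x y => - star Q x y) (fun x y => - nw Q x y) (se D).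
Proof.
move=> p q x; rewrite [LHS]dual_opE; last exact: co_bt_r_linear.
dual_op_coboundary.
Qed.

(** After cancellation the pairs [(l, m)] are [(-wedge, sw)], [(ne, -vee)], [(-prec, ne)],
    [(sw, -succ)] and [(-nw, -se)], in the order of these five definitions. *)
Definition succ_dual := coboundary_dualD ne_dual se_dual.
Definition prec_dual := coboundary_dualD nw_dual sw_dual.
Definition vee_dual := coboundary_dualD sw_dual se_dual.
Definition wedge_dual := coboundary_dualD nw_dual ne_dual.
Definition star_dual :=
  coboundary_dualD (coboundary_dualD wedge_dual sw_dual) se_dual.

(** [h1], [h2] describe the inner and outer operations on the left of the axiom, [h3], [h4] the
    outer and inner ones on the right. By the axioms of [Q], terms with [x] in the second leg
    cancel, while those with [x] in the third and first legs regroup into the two halves of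
    [LRdiff]. The terms containing [l2 x v'] fix the sign [c]. *)
Ltac coboundary_assoc c h1 h2 h3 h4 :=
  apply: (@dual_eq_iff _ _ c);
    [ by rewrite ?oppr_eq0 oner_eq0
    | let p := fresh "p" in let q := fresh "q" in let s := fresh "s" in
      let x := fresh "x" in
      move=> p q s x;
      rewrite [LHS](coboundary_dual_assoc h1 h2 h3 h4) ?mulN1r ?mul1r;
      rewrite pair3_LRdiff; [|quadri_linear|quadri_linear|quadri_linear];
      rewrite /Q11 /Q12 /Q21 /Q22 /Q31 /Q32 ?(pair3D, pair3N);
      repeat first
        [ rewrite pair3_r12_13; [|quadri_linear|quadri_linear|quadri_linear]
        | rewrite pair3_r13_23; [|quadri_linear|quadri_linear|quadri_linear]
        | rewrite pair3_r23_12; [|quadri_linear|quadri_linear|quadri_linear] ];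
      rewrite -?(tliftN, tliftD);
      apply: eq_tlift => u v;
      rewrite -?(tliftN, tliftD); apply: eq_tlift => u' v';
      quadri_normalize hQ;
      rewrite ?(linearDN (dual_linear p)) ?(linearDN (dual_linear q));
      rewrite ?(linearDN (dual_linear s));
      ring ].

(** The difference collapses to [se] on [r23_12], minus [star] on [r12_13], minus [nw] on
    [r13_23]. *)
Lemma dual_nw_nw :
  (forall p q s, nw D (nw D p q) s = nw D p (star D q s)) <->
  (forall x, LRdiff (se Q) (star Q) x (Q12 Q r - Q31 Q r) = 0).
Proof. coboundary_assoc (1 : F^o) nw_dual nw_dual nw_dual star_dual. Qed.

Lemma dual_ne_nw :
  (forall p q s, nw D (ne D p q) s = ne D p (prec D q s)) <->
  (forall x, LRdiff (se Q) (prec Q) x (Q12 Q r) = 0).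
Proof. coboundary_assoc (-1 : F^o) ne_dual nw_dual ne_dual prec_dual. Qed.

Lemma dual_wedge_ne :
  (forall p q s, ne D (wedge D p q) s = ne D p (succ D q s)) <->
  (forall x, LRdiff (vee Q) (prec Q) x (Q31 Q r) = 0).
Proof. coboundary_assoc (1 : F^o) wedge_dual ne_dual ne_dual succ_dual. Qed.

Lemma dual_sw_nw :
  (forall p q s, nw D (sw D p q) s = sw D p (wedge D q s)) <->
  (forall x, LRdiff (se Q) (wedge Q) x (Q21 Q r) = 0).
Proof. coboundary_assoc (1 : F^o) sw_dual nw_dual sw_dual wedge_dual. Qed.

(** The sum collapses to [nw] on [r12_13], minus [star] on [r23_12], plus [se] on [r13_23]. *)
Lemma dual_se_nw :
  (forall p q s, nw D (se D p q) s = se D p (nw D q s)) <->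
  (forall x, LRdiff (se Q) (nw Q) x (Q21 Q r + Q32 Q r) = 0).
Proof. coboundary_assoc (-1 : F^o) se_dual nw_dual se_dual nw_dual. Qed.

Lemma dual_vee_ne :
  (forall p q s, ne D (vee D p q) s = se D p (ne D q s)) <->
  (forall x, LRdiff (vee Q) (nw Q) x (Q32 Q r) = 0).
Proof. coboundary_assoc (1 : F^o) vee_dual ne_dual se_dual ne_dual. Qed.

Lemma dual_prec_sw :
  (forall p q s, sw D (prec D p q) s = sw D p (vee D q s)) <->
  (forall x, LRdiff (succ Q) (wedge Q) x (Q22 Q r) = 0).
Proof. coboundary_assoc (1 : F^o) prec_dual sw_dual sw_dual vee_dual. Qed.

Lemma dual_succ_sw :
  (forall p q s, sw D (succ D p q) s = se D p (sw D q s)) <->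
  (forall x, LRdiff (succ Q) (nw Q) x (Q11 Q r) = 0).
Proof. coboundary_assoc (-1 : F^o) succ_dual sw_dual se_dual sw_dual. Qed.

(** The sum collapses to [star] on [r13_23], plus [se] on [r12_13], minus [nw] on [r23_12]. *)
Lemma dual_star_se :
  (forall p q s, se D (star D p q) s = se D p (se D q s)) <->
  (forall x, LRdiff (star Q) (nw Q) x (Q31 Q r + Q32 Q r) = 0).
Proof. coboundary_assoc (-1 : F^o) star_dual se_dual se_dual se_dual. Qed.

End DualCoboundary.

Theorem theorem6p6 (F : fieldType) (A : vectType F) (Q : quadri_ops A)
    (hQ : is_quadri_algebra Q) (r : tensor A A) (hr : skew_symmetric r) :
  is_quadri_bialgebra Q (r_coops Q r)
  <->
  (forall x : A,
    LRdiff (se Q) (star Q) x (Q12 Q r - Q31 Q r) = 0 /\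
    LRdiff (se Q) (prec Q) x (Q12 Q r) = 0 /\
    LRdiff (vee Q) (prec Q) x (Q31 Q r) = 0 /\
    LRdiff (se Q) (wedge Q) x (Q21 Q r) = 0 /\
    LRdiff (se Q) (nw Q) x (Q21 Q r + Q32 Q r) = 0 /\
    LRdiff (vee Q) (nw Q) x (Q32 Q r) = 0 /\
    LRdiff (succ Q) (wedge Q) x (Q22 Q r) = 0 /\
    LRdiff (succ Q) (nw Q) x (Q11 Q r) = 0 /\
    LRdiff (star Q) (nw Q) x (Q31 Q r + Q32 Q r) = 0).
Proof.
(* Necessity is read off from the dual quadri-algebra alone. *)
split=> [/bialg_coalgebra/dual_quadri_algebra hD x | hE].
  split; first exact: (dual_nw_nw hQ r).1 (nw_nw hD) x.
  split; first exact: (dual_ne_nw hQ r).1 (ne_nw hD) x.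
  split; first exact: (dual_wedge_ne hQ r).1 (wedge_ne hD) x.
  split; first exact: (dual_sw_nw hQ r).1 (sw_nw hD) x.
  split; first exact: (dual_se_nw hQ r).1 (se_nw hD) x.
  split; first exact: (dual_vee_ne hQ r).1 (vee_ne hD) x.
  split; first exact: (dual_prec_sw hQ r).1 (prec_sw hD) x.
  split; first exact: (dual_succ_sw hQ r).1 (succ_sw hD) x.
  exact: (dual_star_se hQ r).1 (star_se hD) x.
have la := co_a_r_linear hQ r; have lb := co_b_r_linear hQ r.
have lat := co_at_r_linear hQ r; have lbt := co_bt_r_linear hQ r.
(* Linearity of the co-operations gives bilinearity on the dual, which leaves exactly its nine
   axioms. *)
apply: r_coops_bialgebra => //; split=> //; split; try exact: dual_op_bilinear.
- by apply/(dual_nw_nw hQ r) => x; have [] := hE x.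
- by apply/(dual_ne_nw hQ r) => x; have [_ []] := hE x.
- by apply/(dual_wedge_ne hQ r) => x; have [_ [_ []]] := hE x.
- by apply/(dual_sw_nw hQ r) => x; have [_ [_ [_ []]]] := hE x.
- by apply/(dual_se_nw hQ r) => x; have [_ [_ [_ [_ []]]]] := hE x.
- by apply/(dual_vee_ne hQ r) => x; have [_ [_ [_ [_ [_ []]]]]] := hE x.
- by apply/(dual_prec_sw hQ r) => x; have [_ [_ [_ [_ [_ [_ []]]]]]] := hE x.
- by apply/(dual_succ_sw hQ r) => x;
    have [_ [_ [_ [_ [_ [_ [_ []]]]]]]] := hE x.
- by apply/(dual_star_se hQ r) => x;
    have [_ [_ [_ [_ [_ [_ [_ [_]]]]]]]] := hE x.
Qed.
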